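(* For every integer $k\ge 0$, let $G_k(x)=\sum_{n\ge 0}s_n^k(231,321)\,x^n$ be the generating function for $\{s_n^k(231,321)\}_{n\ge 0}$. Then $$G_k(x)=\frac{x^k(1-x)^{k+1}}{(1-x-x^2)^{k+1}}.$$ In particular, $s_n^0(231,321)=F_{n-2}$ for all $n\ge 2$, where $\{F_n\}_{n\ge 0}$ is the Fibonacci sequence initialized by $F_0=F_1=1$.
   Context: $S_n$ denotes the set of permutations of $\{1,\dots,n\}$ written in one-line notation $\pi=\pi_1\pi_2\cdots\pi_n$ ($S_0$ consists of the single empty permutation, which has no fixed points and avoids every pattern of length three). For $\alpha\in S_m$, $\pi\in S_n$ contains the pattern $\alpha$ if there are indices $i_1<i_2<\dots<i_m$ such that $\pi_{i_1}\pi_{i_2}\cdots\pi_{i_m}$ is order-isomorphic to $\alpha$; otherwise $\pi$ avoids $\alpha$. For a set $T$ of patterns, $S_n^k(T)$ is the set of $\pi\in S_n$ that have exactly $k$ fixed points (indices $i$ with $\pi_i=i$) and avoid every pattern in $T$; $s_n^k(T)=|S_n^k(T)|$, and $s_n^k(T)=0$ if $k<0$ or $k>n$. The braces around $T$ are omitted, e.g. $s_n^k(231,321)=s_n^k(\{231,321\})$. The Fibonacci numbers satisfy $F_n=F_{n-1}+F_{n-2}$ for $n\ge 2$. Generating functions are formal power series. *)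

(* Defs.v *)
From HB Require Import structures.
From mathcomp Require Import all_boot all_order all_algebra all_fingroup.
From mathcomp Require Import boolp.

Set Implicit Arguments.
Unset Strict Implicit.
Unset Printing Implicit Defensive.

Import GRing.Theory.

(** [{fps R}] is the commutative ring of sequences of coefficients in [R] with
    the Cauchy product.  A series is a unit iff its constant coefficient is a unit,
    and [f / g] is the usual quotient when [g] is a unit. *)

Record fps (R : Type) := FPS { coefs : nat -> R }.

Notation "{ 'fps' R }" := (fps R) (at level 0, format "{ 'fps'  R }").

Lemma fpsP (R : Type) (f g : {fps R}) :
  (forall n, coefs f n = coefs g n) <-> f = g.
Proof.
split=> [|-> //]; case: f => f; case: g => g /= fg.
by congr FPS; apply/funext.
Qed.

HB.instance Definition _ (R : Type) := gen_eqMixin {fps R}.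
HB.instance Definition _ (R : Type) := gen_choiceMixin {fps R}.

Section FpsRing.
Local Open Scope ring_scope.
Variable R : comUnitRingType.
Implicit Types f g h : {fps R}.

Definition fps_zero : {fps R} := FPS (fun=> 0).
Definition fps_opp f : {fps R} := FPS (fun n => - coefs f n).
Definition fps_add f g : {fps R} := FPS (fun n => coefs f n + coefs g n).
Definition fps_one : {fps R} := FPS (fun n => (n == 0%N)%:R).
Definition fps_mul f g : {fps R} :=
  FPS (fun n => \sum_(i < n.+1) coefs f i * coefs g (n - i)).

Lemma fps_addA : associative fps_add.
Proof. by move=> f g h; apply/fpsP => n /=; rewrite addrA. Qed.

Lemma fps_addC : commutative fps_add.
Proof. by move=> f g; apply/fpsP => n /=; rewrite addrC. Qed.

Lemma fps_add0 : left_id fps_zero fps_add.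
Proof. by move=> f; apply/fpsP => n /=; rewrite add0r. Qed.

Lemma fps_addN : left_inverse fps_zero fps_opp fps_add.
Proof. by move=> f; apply/fpsP => n /=; rewrite addNr. Qed.

HB.instance Definition _ :=
  GRing.isZmodule.Build {fps R} fps_addA fps_addC fps_add0 fps_addN.

Definition fps_trunc (N : nat) f : {poly R} := \poly_(i < N) coefs f i.

Lemma coef_fps_mul N f g n : (n < N)%N ->
  coefs (fps_mul f g) n = (fps_trunc N f * fps_trunc N g)`_n.
Proof.
move=> ltnN; rewrite coefM /=; apply: eq_bigr => i _.
have leN m : (m <= n)%N -> (m < N)%N by move/leq_ltn_trans; apply.
by rewrite !coef_poly !leN ?leq_subr // -ltnS.
Qed.

Lemma coef_trunc_mul N f g n : (n < N)%N ->
  (fps_trunc N (fps_mul f g))`_n = (fps_trunc N f * fps_trunc N g)`_n.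
Proof. by move=> ltnN; rewrite coef_poly ltnN (coef_fps_mul f g ltnN). Qed.

Lemma fps_mulC : commutative fps_mul.
Proof.
by move=> f g; apply/fpsP => n; rewrite !(coef_fps_mul _ _ (ltnSn n)) mulrC.
Qed.

Lemma fps_mulA : associative fps_mul.
Proof.
move=> f g h; apply/fpsP => n; rewrite !(coef_fps_mul _ _ (ltnSn n)).
transitivity ((fps_trunc n.+1 f * fps_trunc n.+1 g * fps_trunc n.+1 h)`_n).
  rewrite -mulrA !coefM; apply: eq_bigr => i _; congr (_ * _).
  by rewrite coef_trunc_mul // ltnS leq_subr.
rewrite !coefM; apply: eq_bigr => i _; congr (_ * _).
by rewrite coef_trunc_mul.
Qed.

Lemma fps_mul1 : left_id fps_one fps_mul.
Proof.
move=> f; apply/fpsP => n /=.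
by rewrite big_ord_recl /= subn0 mul1r big1 ?addr0 // => i _; rewrite mul0r.
Qed.

Lemma fps_mulDl : left_distributive fps_mul fps_add.
Proof.
move=> f g h; apply/fpsP => n /=; rewrite -big_split /=.
by apply: eq_bigr => i _; rewrite mulrDl.
Qed.

Lemma fps_one_neq0 : fps_one != 0.
Proof.
by apply/eqP => /fpsP/(_ 0%N)/= /eqP; rewrite oner_eq0.
Qed.

HB.instance Definition _ :=
  GRing.Zmodule_isComNzRing.Build {fps R}
    fps_mulA fps_mulC fps_mul1 fps_mulDl fps_one_neq0.

Definition fps_unit : {pred {fps R}} :=
  fun f => coefs f 0 \is a GRing.unit.

(* The first [n] coefficients of 1/f, obtained by solving the equations
   \sum_(i <= n) f_(n - i) g_i = [n = 0] successively for g_0, g_1, ... *)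
Fixpoint fps_inv_seq f (n : nat) : seq R :=
  if n is m.+1 then
    let s := fps_inv_seq f m in
    rcons s ((coefs f 0)^-1 *
             ((m == 0%N)%:R - \sum_(i < m) coefs f (m - i) * s`_i))
  else [::].

Definition fps_inv f : {fps R} :=
  if fps_unit f then FPS (fun n => (fps_inv_seq f n.+1)`_n) else f.

Lemma size_fps_inv_seq f n : size (fps_inv_seq f n) = n.
Proof. by elim: n => //= n IHn; rewrite size_rcons IHn. Qed.

Lemma nth_fps_inv_seq f n i : (i < n)%N ->
  (fps_inv_seq f n)`_i = (fps_inv_seq f i.+1)`_i.
Proof.
elim: n => // n IHn; rewrite ltnS leq_eqVlt => /predU1P[-> //|ltin].
by rewrite [LHS]/= nth_rcons size_fps_inv_seq ltin IHn.
Qed.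

Lemma fps_mulVf : {in fps_unit, left_inverse 1 fps_inv *%R}.
Proof.
move=> f Uf; rewrite mulrC /fps_inv; have -> : fps_unit f by [].
apply/fpsP => n /=; rewrite (reindex_inj rev_ord_inj) /= big_ord_recr /=.
rewrite !subSS subnn subn0 nth_rcons size_fps_inv_seq ltnn eqxx mulrA mulrV //.
rewrite mul1r addrC -addrA [X in _ + X]addrC.
rewrite [X in _ + (X - _)](_ : _ = \sum_(i < n)
   coefs f (n - i) * (fps_inv_seq f n)`_i) ?subrr ?addr0 //.
apply: eq_bigr => i _; rewrite !subSS subKn ?(ltnW (ltn_ord i)) //.
by congr (_ * _); rewrite (nth_fps_inv_seq _ (ltn_ord i)).
Qed.

Lemma fps_unitPl f g : g * f = 1 -> fps_unit f.
Proof.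
move=> /fpsP/(_ 0%N) /=; rewrite big_ord1 /= subn0 => gf1; apply/unitrP.
by exists (coefs g 0); rewrite [coefs f 0 * _]mulrC gf1.
Qed.

Lemma fps_inv_out : {in [predC fps_unit], fps_inv =1 id}.
Proof. by move=> f; rewrite inE /fps_inv /fps_unit unfold_in => /negPf->. Qed.

HB.instance Definition _ :=
  GRing.ComNzRing_hasMulInverse.Build {fps R}
    fps_mulVf fps_unitPl fps_inv_out.

Definition fps_X : {fps R} := FPS (fun n => (n == 1%N)%:R).

Lemma fps_unitE f : (f \is a GRing.unit) = (coefs f 0 \is a GRing.unit).
Proof. by []. Qed.

End FpsRing.

Definition gen_fun (a : nat -> nat) : {fps int} := FPS (fun n => Posz (a n)).

(** [{1, ..., n}] is represented by ['I_n], that is by [{0, ..., n-1}]; the shift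
    affects neither the relative order of entries nor the fixed points. *)

Definition oneline (n : nat) (p : 'S_n) : seq nat :=
  [seq (p i).+1 | i <- enum 'I_n].

Definition contains (m n : nat) (a : 'S_m) (p : 'S_n) : bool :=
  [exists f : {ffun 'I_m -> 'I_n},
    [forall i : 'I_m, forall j : 'I_m, (i < j) ==> (f i < f j)] &&
    [forall i : 'I_m, forall j : 'I_m, (p (f i) < p (f j)) == (a i < a j)]].

Definition avoids (m n : nat) (a : 'S_m) (p : 'S_n) : bool := ~~ contains a p.

Definition pattern := {m : nat & 'S_m}.
Definition Pattern (m : nat) (a : 'S_m) : pattern := existT (fun m => 'S_m) m a.

Definition fixpoints (n : nat) (p : 'S_n) : {set 'I_n} := [set i | p i == i].

Definition S_ (n k : nat) (T : seq pattern) : {set 'S_n} :=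
  [set p : 'S_n | (#|fixpoints p| == k) &&
                  all (fun a : pattern => avoids (projT2 a) p) T].

Definition s_ (n k : nat) (T : seq pattern) : nat := #|S_ n k T|.

Definition p231 : 'S_3 := perm (@ordS_inj 3).
Definition p321 : 'S_3 := perm (@rev_ord_inj 3).

Lemma oneline_p231 : oneline p231 = [:: 2; 3; 1].
Proof. by rewrite /oneline !enum_ordSl enum_ord0 /= !permE. Qed.

Lemma oneline_p321 : oneline p321 = [:: 3; 2; 1].
Proof. by rewrite /oneline !enum_ordSl enum_ord0 /= !permE. Qed.

Fixpoint fib (n : nat) : nat :=
  match n with
  | 0 | 1 => 1
  | (n''.+1 as n').+1 => fib n' + fib n''
  end.

(* Main.v *)
Require Import Defs.
From mathcomp Require Import all_boot all_order all_algebra all_fingroup.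
From mathcomp Require Import zify ring.

(** A permutation avoids 231 and 321 iff no entry is preceded by two larger
    ones.  Hence, in such a permutation of size [n + 2], the last entry is the
    largest value or the second largest, and deleting it (and standardizing)
    leaves a permutation of size [n + 1] of the same kind.  Conversely, either of
    these two values can be appended to any such permutation
    ([at_most_one_larger_before_lift]).

    Appending the largest value creates exactly one fixed point, the last
    position.  Appending the second largest creates none, because it raises only
    the old maximum; it destroys a fixed point exactly when the old maximum stood
    last.  So let [s_last_fixed n k] and [s_last_moved n k] count the avoiders of
    size [n + 1] with [k] fixed points, according to whether the last position is
    fixed or not.
    Then [s_last_fixed n k.+1 = s_ n k] and
    [s_last_moved n.+1 k = s_last_fixed n k.+1 + s_last_moved n k].

    Eliminating the two auxiliary counts gives a recurrence for [s_] alone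
    ([s_rec0], [s_recS]).  For [k = 0] it is the Fibonacci recurrence.  In terms of
    generating functions it reads [G_0 (1 - x - x^2) = 1 - x] and
    [G_(k+1) (1 - x - x^2) = x (1 - x) G_k], which determine every [G_k] since
    [1 - x - x^2] is invertible.

    In structural terms, the avoiders are the direct sums of blocks
    [m 1 2 ... m-1], and their fixed points are the blocks of size 1; appending the
    largest value opens a new block, appending the second largest extends the last
    block by one. *)

Set Implicit Arguments.
Unset Strict Implicit.
Unset Printing Implicit Defensive.

Import GRing.Theory.

(** * Avoiding 231 and 321 *)

Definition at_most_one_larger_before (n : nat) (p : 'S_n) : bool :=
  [forall i : 'I_n, forall j : 'I_n, forall k : 'I_n,
    (i < j < k) ==> ((p i < p k) || (p j < p k))].

Lemma at_most_one_larger_beforeP (n : nat) (p : 'S_n) :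
  reflect (forall i j k : 'I_n, i < j -> j < k -> (p i < p k) || (p j < p k))
          (at_most_one_larger_before p).
Proof.
apply: (iffP forallP) => [H i j k ij jk|H i].
  by move/forallP/(_ j)/forallP/(_ k)/implyP: (H i); apply; rewrite ij.
apply/forallP => j; apply/forallP => k.
by apply/implyP => /andP[ij jk]; apply: H.
Qed.

(** Listing the three positions of an occurrence as an increasing sequence lets
    concrete patterns be handled by case analysis, in place of a finite function
    on ['I_3]. *)
Lemma contains3P (n : nat) (a : 'S_3) (p : 'S_n) :
  reflect (exists x : seq 'I_n, [/\ size x = 3,
             sorted (fun i j : 'I_n => i < j) x &
             forall d (i j : 'I_3), (p (nth d x i) < p (nth d x j)) = (a i < a j)])
          (contains a p).
Proof.
apply: (iffP existsP) => [[f /andP[/forallP fI /forallP fP]]|[x [sx xI xP]]].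
  have fI2 (i j : 'I_3) : i < j -> f i < f j.
    by move=> ij; move/forallP/(_ j)/implyP: (fI i); apply.
  exists [seq f i | i <- enum 'I_3]; split; first by rewrite size_map size_enum_ord.
    by rewrite !enum_ordSl enum_ord0 /= !fI2.
  move=> d i j; move/forallP/(_ j)/eqP: (fP i) => <-.
  suff fE (l : 'I_3) : nth d [seq f l' | l' <- enum 'I_3] l = f l by rewrite !fE.
  by rewrite (nth_map l) ?size_enum_ord // nth_ord_enum.
case: x sx xI xP => [|i [|j [|k []]]] //= _ /and3P[ij jk _] xP.
exists [ffun m : 'I_3 => nth i [:: i; j; k] m]; apply/andP; split.
  apply/forallP => -[[|[|[|l]]] Hl] //; apply/forallP => -[[|[|[|m]]] Hm] //;
  rewrite !ffunE //=; exact: ltn_trans jk.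
by apply/forallP => l; apply/forallP => m; rewrite !ffunE xP.
Qed.

(** Two entries larger than a later one form with it a 231 or a 321, according to
    their relative order. *)
Lemma avoids_231_321E (n : nat) (p : 'S_n) :
  avoids p231 p && avoids p321 p = at_most_one_larger_before p.
Proof.
rewrite -negb_or; apply/norP/at_most_one_larger_beforeP => [[n231 n321] i j k ij jk|H].
  have ik := ltn_trans ij jk.
  apply/negPn/negP; rewrite negb_or -!leqNgt => /andP[ki kj].
  have neq (u v : 'I_n) : u < v -> (p u : nat) != p v.
    by move=> uv; rewrite (inj_eq val_inj) (inj_eq perm_inj) -val_eqE /=; lia.
  have := neq _ _ ij; have := neq _ _ jk; have := neq _ _ ik.
  case: (ltnP (p i) (p j)) => pij nik njk nij.
    case/negP: n231; apply/contains3P; exists [:: i; j; k]; split => //=.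
      by rewrite ij jk.
    by move=> d [[|[|[|l]]] Hl] // [[|[|[|m]]] Hm] //; rewrite !permE /=; lia.
  case/negP: n321; apply/contains3P; exists [:: i; j; k]; split => //=.
    by rewrite ij jk.
  by move=> d [[|[|[|l]]] Hl] // [[|[|[|m]]] Hm] //; rewrite !permE /=; lia.
pose o0 : 'I_3 := @Ordinal 3 0 isT; pose o1 : 'I_3 := @Ordinal 3 1 isT.
pose o2 : 'I_3 := @Ordinal 3 2 isT.
split; apply/contains3P => -[x [sx xI xP]];
  case: x sx xI xP => [|i [|j [|k []]]] //= _ /and3P[ij jk _] xP;
  by have := H _ _ _ ij jk; rewrite (xP i o0 o2) (xP i o1 o2) !permE.
Qed.

(** * Appending a last value *)

(** [lift_perm ord_max j q] appends the value [j] to [q], raising the values of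
    [q] that are at least [j]; every permutation arises so, by deleting its last
    entry. *)
Lemma lift_perm_ord_max_onto (n : nat) (p : 'S_n.+1) :
  exists q : 'S_n, p = lift_perm ord_max (p ord_max) q.
Proof.
have un k : {l | p (lift ord_max k) = lift (p ord_max) l}.
  have : p ord_max != p (lift ord_max k) by rewrite (inj_eq perm_inj) neq_lift.
  by case/unlift_some => l; exists l.
have inj : injective (fun k => sval (un k)).
  move=> k l /= E; apply: (@lift_inj _ ord_max); apply: (@perm_inj _ p).
  by apply: (etrans (svalP (un k))); rewrite E; apply/esym/(svalP (un l)).
exists (perm inj); apply/permP => k; case: (unliftP ord_max k) => [l ->|->].
  by rewrite lift_perm_lift permE; apply: (svalP (un l)).
by rewrite lift_perm_id.
Qed.

Lemma card_last_value (n : nat) (j : 'I_n.+1) (P : pred 'S_n.+1) :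
  #|[set p | P p & p ord_max == j]| =
  #|[set q : 'S_n | P (lift_perm ord_max j q)]|.
Proof.
have inj : injective (@lift_perm n ord_max j).
  move=> q r /permP E; apply/permP => k; apply: (@lift_inj _ j).
  by rewrite -!(lift_perm_lift ord_max) E.
rewrite -(card_imset _ inj); apply: eq_card => p; rewrite !inE.
apply/andP/imsetP => [[Pp /eqP pj]|[q]].
  have [q pq] := lift_perm_ord_max_onto p; rewrite pj in pq.
  by exists q; rewrite // inE -pq.
by rewrite inE => Pq ->; rewrite lift_perm_id.
Qed.

Lemma ltn_lift (n : nat) (j : 'I_n.+1) (u v : 'I_n) :
  (lift j u < lift j v) = (u < v).
Proof. by rewrite /= !ltnNge leq_bump2. Qed.

(** Appending keeps the relative order of the old entries, so the only new
    condition is on the last entry [j]: exactly [n - j] entries exceed it, and at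
    most one may. *)
Lemma at_most_one_larger_before_lift (n : nat) (j : 'I_n.+1) (q : 'S_n) :
  at_most_one_larger_before (lift_perm ord_max j q) =
  at_most_one_larger_before q && (n <= j.+1).
Proof.
set p := lift_perm _ _ _.
have pj : p ord_max = j by rewrite /p lift_perm_id.
apply/at_most_one_larger_beforeP/andP =>
  [H|[/at_most_one_larger_beforeP Hq Hj] a b c ab bc].
  split.
    apply/at_most_one_larger_beforeP => a b c ab bc.
    have := H (lift ord_max a) (lift ord_max b) (lift ord_max c).
    by rewrite /p !lift_perm_lift !ltn_lift; apply.
  rewrite leqNgt; apply/negP => ltj.
  have j1 : j.+1 < n.+1 by lia.
  have j2 : j.+2 < n.+1 by lia.
  (* The values j+1 and j+2 would both precede the final j. *)
  pose a := (p^-1)%g (Ordinal j1); pose b := (p^-1)%g (Ordinal j2).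
  have pa : p a = j.+1 :> nat by rewrite /a permKV.
  have pb : p b = j.+2 :> nat by rewrite /b permKV.
  have lt_max c : (j < p c) -> c < (ord_max : 'I_n.+1).
    move=> jc; suff: c != ord_max by rewrite -val_eqE /=; have := ltn_ord c; lia.
    by apply/eqP => E; rewrite E pj ltnn in jc.
  have am : a < (ord_max : 'I_n.+1) by apply: lt_max; lia.
  have bm : b < (ord_max : 'I_n.+1) by apply: lt_max; lia.
  case: (ltngtP a b) => [ab|ba|/val_inj E].
  - by have := H _ _ _ ab bm; rewrite pj pa pb; lia.
  - by have := H _ _ _ ba am; rewrite pj pa pb; lia.
  - by rewrite E in pa; lia.
have la (d e : 'I_n.+1) : d < e -> exists d' : 'I_n, d = lift ord_max d'.
  move=> de; case: (unliftP ord_max d) => [d' ->|E]; first by exists d'.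
  by move: de (ltn_ord e); rewrite E /=; lia.
have [a' Ea] := la _ _ ab; have [b' Eb] := la _ _ bc; subst a b.
case: (unliftP ord_max c) => [c'|] Ec; subst c.
  rewrite /p !lift_perm_lift !ltn_lift; apply: Hq.
    by move: ab; rewrite !ltn_lift.
  by move: bc; rewrite ltn_lift.
rewrite pj.
have : p (lift ord_max a') != p (lift ord_max b').
  by rewrite (inj_eq perm_inj) -val_eqE; move: ab; case: ltngtP.
have : p (lift ord_max a') != j by rewrite -pj (inj_eq perm_inj) eq_sym neq_lift.
have : p (lift ord_max b') != j by rewrite -pj (inj_eq perm_inj) eq_sym neq_lift.
rewrite -!val_eqE /=.
(* Distinct values other than j cannot both lie above j, since n <= j + 1. *)
move: (p (lift ord_max a')) (p (lift ord_max b')) => u v.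
by have := ltn_ord u; have := ltn_ord v; lia.
Qed.

Lemma card_fixpoints (n : nat) (p : 'S_n) :
  #|fixpoints p| = \sum_(i < n) (p i == i).
Proof.
rewrite -sum1_card big_mkcond; apply: eq_bigr => i _.
by rewrite inE; case: eqP.
Qed.

(** The position [i] of an old entry is kept, so it is fixed when the lifted value
    returns to [i]; the last position is fixed when the largest value is
    appended. *)
Lemma card_fixpoints_lift (n : nat) (j : 'I_n.+1) (q : 'S_n) :
  #|fixpoints (lift_perm ord_max j q)| =
  \sum_(i < n) (lift j (q i) == i :> nat) + (j == ord_max).
Proof.
rewrite card_fixpoints big_ord_recr /= lift_perm_id; congr (_ + _).
apply: eq_bigr => i _.
have -> : widen_ord (leqnSn n) i = lift ord_max i.
  by apply: val_inj; rewrite [RHS]lift_max.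
by rewrite lift_perm_lift -val_eqE [val (lift ord_max i)]lift_max.
Qed.

Lemma card_fixpoints_append_max (n : nat) (q : 'S_n) :
  #|fixpoints (lift_perm ord_max ord_max q)| = #|fixpoints q|.+1.
Proof.
rewrite card_fixpoints_lift eqxx addn1 card_fixpoints; congr _.+1.
by apply: eq_bigr => i _; rewrite lift_max.
Qed.

Definition ord_submax (n : nat) : 'I_n.+2 := lift ord_max ord_max.

(** Of the old values only the maximum is raised, to a value no old position can
    have; so a fixed point is lost exactly when the last position was fixed. *)
Lemma card_fixpoints_append_submax (n : nat) (q : 'S_n.+1) :
  #|fixpoints q| =
  #|fixpoints (lift_perm ord_max (ord_submax n) q)| + (q ord_max == ord_max).
Proof.
rewrite card_fixpoints_lift card_fixpoints.
have -> : (ord_submax n == ord_max) = false by rewrite eq_sym (negPf (neq_lift _ _)).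
rewrite addn0 !big_ord_recr /= /bump ltnn add0n.
have -> : ((n <= q ord_max) + q ord_max == n) = false.
  by have := ltn_ord (q ord_max); lia.
rewrite addn0; congr (_ + _); apply: eq_bigr => i _; congr nat_of_bool.
rewrite -val_eqE /=; have := ltn_ord i.
by have := ltn_ord (q (widen_ord (leqnSn n) i)); lia.
Qed.

(** * Recurrences for the number of avoiders *)

Local Notation T := [:: Pattern p231; Pattern p321].

Lemma in_S (n k : nat) (p : 'S_n) :
  (p \in S_ n k T) = (#|fixpoints p| == k) && at_most_one_larger_before p.
Proof. by rewrite inE /= andbT avoids_231_321E. Qed.

Definition s_last_fixed (n k : nat) : nat :=
  #|[set p : 'S_n.+1 | p \in S_ n.+1 k T & p ord_max == ord_max]|.
Definition s_last_moved (n k : nat) : nat :=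
  #|[set p : 'S_n.+1 | p \in S_ n.+1 k T & p ord_max != ord_max]|.

Lemma s_last_split (n k : nat) : s_ n.+1 k T = s_last_fixed n k + s_last_moved n k.
Proof.
rewrite /s_ -(cardsID [set p : 'S_n.+1 | p ord_max == ord_max]); congr (_ + _).
  by apply: eq_card => p; rewrite !inE.
by apply: eq_card => p; rewrite !inE andbC.
Qed.

Lemma s_last_fixed_0 (n : nat) : s_last_fixed n 0 = 0.
Proof.
rewrite /s_last_fixed card_last_value; apply/eqP; rewrite cards_eq0.
by apply/eqP/setP => q; rewrite [LHS]inE in_S card_fixpoints_append_max inE.
Qed.

(** When the last position is fixed, deleting it gives an arbitrary avoider with
    one fixed point fewer. *)
Lemma s_last_fixedS (n k : nat) : s_last_fixed n k.+1 = s_ n k T.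
Proof.
rewrite /s_last_fixed card_last_value; apply: eq_card => q.
rewrite [LHS]inE !in_S card_fixpoints_append_max at_most_one_larger_before_lift eqSS /=.
by rewrite leqnSn andbT.
Qed.

(** When the last position is not fixed, the last value is the second largest.
    Deleting it restores a fixed point if the remaining permutation ends with its
    maximum, and keeps the number of fixed points otherwise. *)
Lemma s_last_movedS (n k : nat) :
  s_last_moved n.+1 k = s_last_fixed n k.+1 + s_last_moved n k.
Proof.
have -> : s_last_moved n.+1 k =
    #|[set p : 'S_n.+2 | p \in S_ n.+2 k T & p ord_max == ord_submax n]|.
  apply: eq_card => p; rewrite [LHS]inE [RHS]inE in_S.
  have [q pq] := lift_perm_ord_max_onto p.
  have [|_] := boolP (at_most_one_larger_before p); last by rewrite andbF.
  rewrite pq at_most_one_larger_before_lift -pq => /andP[_ le_n]; congr (_ && _).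
  move: le_n; rewrite -!val_eqE /= /bump ltnn.
  by have := ltn_ord (p ord_max); lia.
rewrite card_last_value.
rewrite -(cardsID [set q : 'S_n.+1 | q ord_max == ord_max]); congr (_ + _);
  apply: eq_card => q; rewrite !inE /= !andbT !avoids_231_321E.
all: rewrite at_most_one_larger_before_lift (card_fixpoints_append_submax q).
all: rewrite lift_max leqnn andbT.
all: by case: (q ord_max == ord_max); rewrite ?addn1 ?addn0 ?eqSS ?andbT ?andbF.
Qed.

Lemma s_rec0 (n : nat) : s_ n.+2 0 T = s_ n 0 T + s_ n.+1 0 T.
Proof. by rewrite !s_last_split s_last_movedS !s_last_fixed_0 s_last_fixedS. Qed.

(** The term [s_ n k T] compensates for the avoiders of size [n + 1] that end with
    their maximum: they are counted in [s_ n.+1 k.+1 T], but appending the second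
    largest value to them leaves only [k] fixed points. *)
Lemma s_recS (n k : nat) :
  s_ n.+2 k.+1 T + s_ n k T = s_ n.+1 k T + s_ n k.+1 T + s_ n.+1 k.+1 T.
Proof.
rewrite [in LHS]s_last_split s_last_movedS !s_last_fixedS.
by rewrite [s_ n.+1 k.+1 T]s_last_split s_last_fixedS; lia.
Qed.

Lemma s_0E (k : nat) : s_ 0 k T = (k == 0).
Proof.
have E (p : 'S_0) : (p \in S_ 0 k T) = (k == 0).
  rewrite in_S card_fixpoints big_ord0 eq_sym; case: eqP => //= _.
  by apply/at_most_one_larger_beforeP => -[].
rewrite /s_ (eq_card E); case: (k == 0); last by rewrite eq_card0.
by rewrite (eq_card (B := predT)) // card_Sn.
Qed.

Lemma s_1E (k : nat) : s_ 1 k T = (k == 1).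
Proof.
have nofix k' : s_last_moved 0 k' = 0.
  apply/eqP; rewrite cards_eq0; apply/eqP/setP => p.
  by rewrite [LHS]inE [p ord_max]ord1 (ord1 ord_max) eqxx andbF inE.
rewrite s_last_split nofix addn0.
by case: k => [|k]; rewrite ?s_last_fixed_0 // s_last_fixedS s_0E.
Qed.

Lemma s_fib (n : nat) : s_ n.+2 0 T = fib n.
Proof.
suff: s_ n.+2 0 T = fib n /\ s_ n.+3 0 T = fib n.+1 by case.
elim: n => [|n [IH1 IH2]]; first by rewrite !s_rec0 s_0E s_1E.
by split; rewrite // s_rec0 IH1 IH2 addnC.
Qed.

(** * Generating functions *)

Local Open Scope ring_scope.

Section Fps.
Variable R : comUnitRingType.
Implicit Types f g : {fps R}.
Local Notation x := (fps_X R).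

Lemma coefsB f g n : coefs (f - g) n = coefs f n - coefs g n. Proof. by []. Qed.
Lemma coefsXM f n : coefs (x * f) n = if n is m.+1 then coefs f m else 0.
Proof.
rewrite /= big_ord_recl /= mul0r add0r; case: n => [|n]; first by rewrite big_ord0.
by rewrite big_ord_recl big1 /= ?mul1r ?addr0 ?subSS ?subn0 // => i _; rewrite mul0r.
Qed.

End Fps.

Local Notation x := (fps_X int).
Local Notation G k := (gen_fun (fun n => s_ n k T)).

Lemma gen_fun_rec0 : G 0%N * (1 - x - x ^+ 2) = 1 - x.
Proof.
(* Nested multiplications by x are index shifts, which can be read off
   coefficientwise; the cases n = 0, 1 lie outside the range of s_rec0. *)
have -> : G 0%N * (1 - x - x ^+ 2) = G 0%N - x * G 0%N - x * (x * G 0%N) by ring.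
apply/fpsP => -[|[|n]]; rewrite !coefsB !coefsXM /=.
- by rewrite s_0E.
- by rewrite s_0E s_1E.
- by rewrite s_rec0; lia.
Qed.

Lemma gen_fun_recS (k : nat) : G k.+1 * (1 - x - x ^+ 2) = x * (1 - x) * G k.
Proof.
have -> : G k.+1 * (1 - x - x ^+ 2) = G k.+1 - x * G k.+1 - x * (x * G k.+1).
  by ring.
have -> : x * (1 - x) * G k = x * G k - x * (x * G k) by ring.
apply/fpsP => -[|[|n]]; rewrite !coefsB !coefsXM /=.
- by rewrite s_0E.
- by rewrite !s_0E s_1E eqSS; lia.
- by have := s_recS n k; lia.
Qed.

Lemma gen_funM (k : nat) :
  G k * (1 - x - x ^+ 2) ^+ k.+1 = x ^+ k * (1 - x) ^+ k.+1.
Proof.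
elim: k => [|k IHk]; first by rewrite !expr1 gen_fun_rec0 expr0 mul1r.
rewrite [_ ^+ k.+2]exprS mulrA gen_fun_recS -[LHS]mulrA IHk !exprS; ring.
Qed.

Theorem theorem2p10 :
  (forall k : nat,
     let x : {fps int} := fps_X int in
     gen_fun (fun n => s_ n k [:: Pattern p231; Pattern p321]) =
       (x ^+ k * (1 - x) ^+ k.+1) / (1 - x - x ^+ 2) ^+ k.+1) /\
  (forall n : nat, (2 <= n)%N ->
     s_ n 0 [:: Pattern p231; Pattern p321] = fib (n - 2)).
Proof.
split=> [k y|[|[|n]] // _]; last by rewrite !subSS subn0 s_fib.
have D_unit : (1 - y - y ^+ 2) ^+ k.+1 \is a GRing.unit.
  by rewrite unitrX // fps_unitE expr2 !coefsB coefsXM.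
by apply: (canRL (mulrK D_unit)); apply: gen_funM.
Qed.
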